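(* For any $k\geq0$, $\tau\in\{1,i\}$, $a\neq0$, define the subspace $$\Sigma_f^\pm=\{\psi\in\Sigma\mid f(v)\cdot\psi=0\ \forall v\in\mathbb R^{n},\ \psi=\pm i\tau e_0\cdot\psi\}$$ of the fibre $\Sigma$ at the identity of the spinor bundle of $(\tilde G^{a,k},\tilde g_{\delta,\epsilon,\tau})$. Then: \begin{enumerate} \item For any nonzero $\psi\in\Sigma_f^\pm$ (extended by left-invariance), $e^{at/2}\psi$ is a Killing spinor on $\tilde G^{a,k}$ with Killing constant $\pm i\tau a/2$. \item If $n=2k$, the space $\Sigma_f^+\oplus\Sigma_f^-$ has dimension one, yielding one Killing spinor with constant equal to $i\tau a/2$ or $-i\tau a/2$ according to whether an even or odd number of the constants $\epsilon_0,\delta_1,\dots,\delta_k$ are positive. \item If $n>2k$, each space $\Sigma_f^\pm$ has dimension $2^{[(n-1)/2]-k}$, yielding $2^{[(n-1)/2]-k}$ linearly independent Killing spinors with Killing constant $i\tau a/2$ and as many with Killing constant $-i\tau a/2$. \end{enumerate}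
   Context: The solvmanifolds $\tilde G^{a,k}$. Let $k\ge0$ and $n\ge 2k$ be integers, $a\in\mathbb R$, $\delta\in\{\pm1\}^k$, $\epsilon\in\{\pm1\}^{n-2k}$, $\tau\in\{1,i\}$, $\epsilon_0=\tau^2$. Write elements of the abelian Lie algebra $\mathbb R^n$ as $(x,y,z)\in\mathbb R^k\times\mathbb R^{n-2k}\times\mathbb R^k$, and in this splitting set $$f=\begin{pmatrix}0&0&I_k\\0&0&0\\0&0&0\end{pmatrix},\qquad g_{\delta,\epsilon}=\begin{pmatrix}0&0&\Delta\\0&E&0\\\Delta&0&0\end{pmatrix},\qquad \Delta=\operatorname{diag}(\delta_1,\dots,\delta_k),\ E=\operatorname{diag}(\epsilon_1,\dots,\epsilon_{n-2k}).$$ (For $k=0$ the variables $x,z$ do not appear and $f=0$.) $\tilde G^{a,k}$ is the connected simply connected Lie group with Lie algebra $\mathbb R^n\rtimes_{\phi_0}\operatorname{Span}\{e_0\}$, where $\mathbb R^n$ is an abelian ideal and $\phi_0=-\operatorname{ad}e_0$ acts on $\mathbb R^n$ as $a\,\mathrm{Id}+f$. Its left-invariant metric is $\tilde g_{\delta,\epsilon,\tau}=g_{\delta,\epsilon}+\epsilon_0e^0\otimes e^0$, where $e^0$ vanishes on $\mathbb R^n$ and $e^0(e_0)=1$. The function $t\colon\tilde G^{a,k}\to\mathbb R$ is the coordinate along the $\mathbb R$ factor, i.e. the Lie group homomorphism with $dt=e^0$. Spinors. The real Clifford algebra of the Lie algebra $\mathbb R^n\oplus\operatorname{Span}\{e_0\}$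 with scalar product $\tilde g=\tilde g_{\delta,\epsilon,\tau}$ uses the convention $v\cdot w+w\cdot v=-2\tilde g(v,w)$, and $\Sigma$ is an irreducible complex representation of it (the spinor representation). Spinors on $\tilde G^{a,k}$ are smooth maps $\tilde G^{a,k}\to\Sigma$ (trivialization by a left-invariant orthonormal frame), left-invariant spinors being the constant maps. If $\{u_h\}$ is a basis of $\Sigma$ and $\psi=\sum_h a_hu_h$, the spinor connection is $\widetilde\nabla_X\psi=\sum_h(\mathcal L_Xa_h)u_h+\frac14\sum_{h,j}a_h\,(e^j)^\sharp\cdot(\widetilde\nabla_Xe_j)\cdot u_h$, where $\widetilde\nabla$ is the Levi-Civita connection, $\{e_j\}$ is a basis of the Lie algebra, $\{e^j\}$ the dual basis and $\tilde g(\alpha^\sharp,w)=\alpha(w)$. A Killing spinor with Killing constant $\lambda\in\mathbb C$, $\lambda\ne0$, is a nonzero spinor $\psi$ with $\widetilde\nabla_X\psi=\lambda X\cdot\psi$ for all vector fields $X$. $[\,\cdot\,]$ denotes the integer part. Orientation (relevant to the sign in item 2, where $n=2k$). With $e_1,\dots,e_k$ the basis of the $x$-factor and $e_{k+1},\dots,e_{2k}$ that of the $z$-factor, the orientation is the one defined by the basis $\{e_0,\dots,e_{2k}\}$, the volume element being taken to be $\omega=e_0\cdot\prod_{i=1}^k\frac12(e_i-e_{k+i})\cdot(e_i+e_{k+i})$, and by convention $\omega$ acts on spinors as multiplication by $\tau i^{k+(n+1)(n+2)/2}=i\tau(-1)^k$.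
   Formalization: In item 2 the parity rule fails for odd k if ω acts as iτ(-1)^k; the formal theorem proves that under this convention the sign is + or − as k plus the number of positive constants is even or odd, and proves the printed rule when ω acts as iτ. *)

(* Defs.v *)
From mathcomp Require Import all_boot all_order all_algebra.
From mathcomp Require Import complex ring.
From mathcomp Require Import all_classical all_reals all_analysis.

Set Implicit Arguments.
Unset Strict Implicit.
Unset Printing Implicit Defensive.
Import Order.TTheory GRing.Theory Num.Theory numFieldNormedType.Exports.

Local Open Scope classical_set_scope.
Local Open Scope ring_scope.
Local Open Scope complex_scope.

(* Column vectors split as (x, y, z) in R^k x R^(n-2k) x R^k; the total size is
   n whenever 2k <= n. *)
Notation splitRn R n k := 'cV[R]_(k + (n - k.*2) + k).

(* (v, r) stands for v + r e_0 in the Lie algebra, and for global coordinates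
   on the simply connected group; the homomorphism t is the second
   projection. *)
Notation solv R n k := (splitRn R n k * R)%type.

Section Solvmanifold.
Variables (R : realType) (n k : nat).
Local Notation V := (splitRn R n k).
Local Notation G := (solv R n k).

Definition fmx : 'M[R]_(k + (n - k.*2) + k) :=
  block_mx 0 (col_mx 1%:M 0) 0 0.

Definition gmx (delta : 'rV[R]_k) (eps : 'rV[R]_(n - k.*2)) :
    'M[R]_(k + (n - k.*2) + k) :=
  block_mx (block_mx 0 0 0 (diag_mx eps)) (col_mx (diag_mx delta) 0)
           (row_mx (diag_mx delta) 0) 0.

(* epsilon_0 = tau^2, which is real for tau in {1, i}. *)
Definition eps0 (tau : R[i]) : R := complex.Re (tau ^+ 2).

Definition metric delta eps tau (X Y : G) : R :=
  (X.1^T *m gmx delta eps *m Y.1) 0 0 + eps0 tau * (X.2 * Y.2).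

Definition phi0 (a : R) : 'M[R]_(k + (n - k.*2) + k) := a%:M + fmx.

(* R^n is abelian and [e_0, v] = - phi0 v. *)
Definition bracket (a : R) (X Y : G) : G :=
  (Y.2 *: (phi0 a *m X.1) - X.2 *: (phi0 a *m Y.1), 0).

(* Semidirect product of R^n and R, with s acting by
   exp (s ad e_0) = exp (- s (a Id + f)) = e^(- a s) (Id - s f), as f^2 = 0. *)
Definition gact (a s : R) : 'M[R]_(k + (n - k.*2) + k) :=
  expR (- (a * s)) *: (1%:M - s *: fmx).

Definition gmul (a : R) (p q : G) : G := (p.1 + gact a p.2 *m q.1, p.2 + q.2).

Definition gone : G := (0, 0).

Definition ginv (a : R) (p : G) : G := (- (gact a (- p.2) *m p.1), - p.2).

(* The value at p of the left-invariant vector field equal to X at gone: the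
   differential at gone of left translation by p, applied to X. *)
Definition linv (a : R) (p : G) (X : G) : G := 'D_X (gmul a p) gone.

Definition tcoord (p : G) : R := p.2.

End Solvmanifold.

Arguments gone {R n k}.
Arguments fmx {R n k}.

Section GroupFacts.
Variables (R : realType) (n k : nat).
Local Notation G := (solv R n k).

Lemma fmx_sqr : fmx *m fmx = 0 :> 'M[R]_(k + (n - k.*2) + k).
Proof.
by rewrite /fmx mulmx_block !mul0mx !mulmx0 !addr0 block_mx0.
Qed.

Lemma gact0 (a : R) : gact n k a 0 = 1%:M.
Proof. by rewrite /gact mulr0 oppr0 expR0 scale0r subr0 scale1r. Qed.

Lemma gactD (a s t : R) : gact n k a (s + t) = gact n k a s *m gact n k a t.
Proof.
rewrite /gact -scalemxAl -scalemxAr scalerA -expRD mulrDr opprD; congr (_ *: _).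
rewrite mulmxBl mul1mx mulmxBr mulmx1 -scalemxAl -scalemxAr fmx_sqr !scaler0.
by rewrite subr0 scalerDl opprD addrA addrAC.
Qed.

Lemma gmulA (a : R) : associative (@gmul R n k a).
Proof.
move=> p q r; rewrite /gmul /= gactD mulmxDr mulmxA !addrA.
by congr (_ , _).
Qed.

Lemma gmul1g (a : R) : left_id gone (@gmul R n k a).
Proof. by move=> [v r]; rewrite /gmul /= gact0 mul1mx !add0r. Qed.

Lemma gmulg1 (a : R) : right_id gone (@gmul R n k a).
Proof. by move=> [v r]; rewrite /gmul /= mulmx0 !addr0. Qed.

Lemma gmulVg (a : R) : left_inverse gone (@ginv R n k a) (@gmul R n k a).
Proof. by move=> [v r]; rewrite /gmul /ginv /= !addNr. Qed.

Lemma derive_cvg (V W : normedModType R) (f : V -> W) a v l :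
  (fun h => h^-1 *: (f (h *: v + a) - f a)) @ 0^' --> l -> 'D_v f a = l.
Proof. by move=> fl; apply: cvg_lim => //; exact: norm_hausdorff. Qed.

Lemma linvE (a : R) (p X : G) : linv a p X = (gact n k a p.2 *m X.1, X.2).
Proof.
apply: derive_cvg.
apply: cvg_near_cst; near=> h.
have h0 : h != 0 by near: h; exact: nbhs_dnbhs_neq.
case: p X => [p1 p2] [X1 X2].
rewrite /gmul /gone /= !addr0 mulmx0 addr0.
congr (_, _) => /=.
  by rewrite addrAC subrr add0r -scalemxAr scalerA mulVf ?scale1r.
by rewrite addrAC subrr add0r scalerA mulVf ?scale1r.
Unshelve. all: by end_near.
Qed.

Lemma derive_linv (a : R) (p X Y : G) :
  'D_X (fun q => linv a q Y) p =
  (- X.2 *: (gact n k a p.2 *m (phi0 n k a *m Y.1)), 0).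
Proof.
have gE (s : R) : gact n k a s *m Y.1 = expR (- a * s) *: Y.1 -
    (expR (- a * s) * s) *: (fmx *m Y.1).
  rewrite /gact -scalemxAl mulmxBl mul1mx -scalemxAl scalerBr scalerA.
  by rewrite mulNr.
have e1 : is_derive p.2 1 (fun s : R => expR (- a * s)) (expR (- a * p.2) * - a).
  have h2 : is_derive p.2 1 (fun s : R => - a * s) (- a).
    by have := is_deriveZ (- a) (is_derive_id p.2 (1:R)); rewrite /GRing.scale /= mulr1.
  have := @is_derive1_comp R expR (fun s : R => - a * s) p.2 _ _ (is_derive_expR _) h2.
  by [].
have e2 : is_derive p.2 1 (fun s : R => expR (- a * s) * s)
     (expR (- a * p.2) * (1 - a * p.2)).
  have := is_deriveM e1 (is_derive_id p.2 (1:R)).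
  move=> h; have E : expR (- a * p.2) * (1 - a * p.2) =
     expR (- a * p.2) *: 1 + p.2 *: (expR (- a * p.2) * - a).
    by rewrite /GRing.scale /=; ring.
  by rewrite E; exact: h.
have cv (h : R -> R) (dh : R) : is_derive p.2 1 h dh ->
    (fun t : R => t^-1 * (h (t * X.2 + p.2) - h p.2)) @ 0^' --> X.2 * dh.
  move=> hd.
  have hX : is_derive p.2 X.2 h (X.2 * dh).
    have /derivable1_diffP hdiff := @ex_derive _ _ _ _ _ _ _ hd.
    apply: DeriveDef; first exact: diff_derivable.
    rewrite deriveE // -[X.2 in LHS]mulr1 linearZ /= -deriveE //.
    by rewrite (@derive_val _ _ _ _ _ _ _ hd).
  have := @ex_derive _ _ _ _ _ _ _ hX; rewrite /derivable => /cvg_ex [l].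
  move=> hl; rewrite -(@derive_val _ _ _ _ _ _ _ hX) /derive.
  by apply: (cvgP l).
apply: derive_cvg.
rewrite (_ : (fun h : R => _) = (fun h : R =>
  ((h^-1 * (expR (- a * (h * X.2 + p.2)) - expR (- a * p.2))) *: Y.1 -
   (h^-1 * (expR (- a * (h * X.2 + p.2)) * (h * X.2 + p.2) -
      expR (- a * p.2) * p.2)) *: (fmx *m Y.1), 0 : R))); last first.
  apply/funext => h /=; rewrite !linvE /= !gE.
  congr (_, _) => /=; last by rewrite subrr scaler0.
  rewrite -[h *: X.2]/(h * X.2) -2!(scalerA h^-1) !scalerBl -scalerBr; congr (_ *: _).
  set A := _ *: Y.1; set B := (_ * _) *: _; set C := _ *: Y.1.
  by set D := (_ * _) *: _; rewrite !opprB [D - C]addrC [D - B]addrC addrACA.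
have -> : - X.2 *: (gact n k a p.2 *m (phi0 n k a *m Y.1)) =
   (X.2 * (expR (- a * p.2) * - a)) *: Y.1 -
   (X.2 * (expR (- a * p.2) * (1 - a * p.2))) *: (fmx *m Y.1).
  have fE : (1%:M - p.2 *: fmx) *m phi0 n k a = a%:M + (1 - a * p.2) *: fmx.
    rewrite /phi0 mulmxDr mul_mx_scalar mulmxBl mul1mx -scalemxAl fmx_sqr.
    rewrite scaler0 subr0 scalerBr scalerA scale_scalar_mx mulr1 scalerBl scale1r.
    by rewrite -addrA [- _ + _]addrC.
  rewrite /gact -scalemxAl mulmxA fE mulmxDl mul_scalar_mx -scalemxAl mulNr.
  move: (expR _) => A; rewrite !scalerDr !scalerA -scaleNr.
  congr (_ + _); last by rewrite -scaleNr mulNr.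
  by congr (_ *: _); ring.
have c1 : _ := cvgZr_tmp (a := Y.1) (cv _ _ e1).
have c2 : _ := cvgZr_tmp (a := fmx *m Y.1) (cv _ _ e2).
have FF : Filter (0 : R)^' by exact: _.
have {}c1 := c1 FF; have {}c2 := c2 FF.
exact: (cvg_pair (cvgB c1 c2) (cvg_cst (0 : R))).
Qed.

(* The bracket of the left-invariant fields X and Y is the left-invariant field
   bracket a X Y. *)
Lemma linv_bracket (a : R) (p X Y : G) :
  'D_(linv a p X) (fun q => linv a q Y) p -
  'D_(linv a p Y) (fun q => linv a q X) p = linv a p (bracket a X Y).
Proof.
rewrite !derive_linv !linvE /bracket /=; congr (_, _); last by rewrite /= subrr.
by rewrite /= mulmxBr -!scalemxAr !scaleNr opprK addrC.
Qed.

End GroupFacts.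

Section Smooth.
Variable R : realType.

Fixpoint Ck (W W' : normedModType R) (m : nat) (F : W -> W') : Prop :=
  if m is m'.+1 then
    (forall p, differentiable F p) /\
    (forall v, Ck m' (fun p => 'D_v F p))
  else continuous F.

Definition smooth (W W' : normedModType R) (F : W -> W') : Prop :=
  forall m, Ck m F.

End Smooth.

Section LeviCivita.
Variables (R : realType) (n k : nat).
Local Notation G := (solv R n k).

(* Connections are described by their values on left-invariant fields. *)
Definition is_levi_civita (g : G -> G -> R) (br nabla : G -> G -> G) : Prop :=
  [/\ (forall X (r : R) Y Z, nabla X (r *: Y + Z) = r *: nabla X Y + nabla X Z),
      (forall Y (r : R) X Z, nabla (r *: X + Z) Y = r *: nabla X Y + nabla Z Y),
      (forall X Y, nabla X Y - nabla Y X = br X Y) &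
      (forall X Y Z, g (nabla X Y) Z + g Y (nabla X Z) = 0)].

Definition sharp (g : G -> G -> R) (alpha : G -> R) : G :=
  xget 0 [set X | forall Y, g X Y = alpha Y].

End LeviCivita.

Section LeviCivitaFacts.
Variables (R : realType) (n k : nat).
Local Notation G := (solv R n k).

Lemma gmx_tr delta eps : (@gmx R n k delta eps)^T = gmx delta eps.
Proof.
rewrite /gmx !tr_block_mx tr_col_mx tr_row_mx !trmx0.
by rewrite !tr_diag_mx.
Qed.

Lemma gmx_phi0 (a : R) delta eps :
  (phi0 n k a)^T *m gmx delta eps = gmx delta eps *m phi0 n k a.
Proof.
rewrite /phi0 linearD /= tr_scalar_mx mulmxDl mulmxDr mul_scalar_mx mul_mx_scalar.
congr (_ + _); rewrite /fmx /gmx tr_block_mx !mulmx_block tr_col_mx !trmx0.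
rewrite trmx1 !(mul0mx, mulmx0, addr0, add0r).
rewrite !mul_row_col mul_block_col !(mul0mx, mulmx0, addr0, add0r).
by rewrite !mul1mx mulmx1 col_mx0 row_mx0.
Qed.

Lemma metricC delta eps tau (X Y : G) :
  metric delta eps tau X Y = metric delta eps tau Y X.
Proof.
rewrite /metric (mulrC X.2); congr (_ + _).
rewrite -[in LHS](trmxK (X.1^T *m _ *m _)) mxE !trmx_mul trmxK gmx_tr.
by rewrite mulmxA.
Qed.

Lemma bil_linr d (M : 'M[R]_d) r (u v w : 'cV[R]_d) :
  (u^T *m M *m (r *: v + w)) 0 0 =
  r * (u^T *m M *m v) 0 0 + (u^T *m M *m w) 0 0.
Proof. by rewrite mulmxDr -scalemxAr mxE mxE. Qed.

Lemma bil_linl d (M : 'M[R]_d) r (u v w : 'cV[R]_d) :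
  ((r *: v + w)^T *m M *m u) 0 0 =
  r * (v^T *m M *m u) 0 0 + (w^T *m M *m u) 0 0.
Proof. by rewrite linearD linearZ /= !mulmxDl -!scalemxAl mxE mxE. Qed.

Lemma bil_Zl d (M : 'M[R]_d) r (u v : 'cV[R]_d) :
  ((r *: v)^T *m M *m u) 0 0 = r * (v^T *m M *m u) 0 0.
Proof. by rewrite linearZ /= -!scalemxAl mxE. Qed.

Lemma levi_civita_exists (a : R) delta eps tau : eps0 tau ^+ 2 = 1 ->
  is_levi_civita (metric delta eps tau) (bracket a)
    (fun X Y : G => (Y.2 *: (phi0 n k a *m X.1),
       - eps0 tau * ((phi0 n k a *m X.1)^T *m gmx delta eps *m Y.1) 0 0)).
Proof.
move=> t2; split.
- move=> X r Y Z; congr (_, _) => /=; first by rewrite scalerDl scalerA.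
  by rewrite bil_linr /GRing.scale /= mulrDr mulrCA.
- move=> Y r X Z; rewrite /= mulmxDr -scalemxAr bil_linl; congr (_, _).
    by rewrite /= scalerDr !scalerA mulrC.
  by rewrite /GRing.scale /= mulrDr mulrCA.
- move=> X Y; congr (_, _) => /=; rewrite -mulrBr.
  rewrite [X in _ * (X - _)](_ : _ = ((phi0 n k a *m Y.1)^T *m gmx delta eps *m X.1) 0 0).
    by rewrite subrr mulr0.
  rewrite -[(phi0 n k a *m X.1)^T *m _ *m _]trmxK mxE 2!trmx_mul trmxK gmx_tr.
  by rewrite [in RHS]trmx_mul -(mulmxA Y.1^T) gmx_phi0 !mulmxA.
- move=> X Y Z; rewrite [X in _ + X]metricC /metric /= !bil_Zl.
  move: (((phi0 n k a *m X.1)^T *m gmx delta eps *m Y.1) 0 0) => A.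
  move: (((phi0 n k a *m X.1)^T *m gmx delta eps *m Z.1) 0 0) => B.
  have -> : Y.2 * B + eps0 tau * (- eps0 tau * A * Z.2) +
    (Z.2 * A + eps0 tau * (- eps0 tau * B * Y.2)) =
    (1 - eps0 tau ^+ 2) * (Y.2 * B + Z.2 * A) by ring.
  by rewrite t2 subrr mul0r.
Qed.

End LeviCivitaFacts.

Section Spinors.
Variables (R : realType) (n k : nat).
Local Notation V := (splitRn R n k).
Local Notation G := (solv R n k).
Variable Sigma : vectType R[i].

(* By the universal property of the Clifford algebra, its complex
   representations on Sigma are the maps c below (c X is Clifford
   multiplication by X); since the algebra is generated by the vectors, its
   invariant subspaces are those of the operators c X. *)
Definition clifford_rep (g : G -> G -> R) (c : G -> 'End(Sigma)) : Prop :=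
  (forall (r : R) X Y, c (r *: X + Y) = r%:C *: c X + c Y) /\
  (forall X Y psi, c X (c Y psi) + c Y (c X psi) = (- 2 * g X Y)%:C *: psi).

Definition irreducible_rep (c : G -> 'End(Sigma)) : Prop :=
  (\dim {:Sigma} != 0)%N /\
  forall U : {vspace Sigma}, (forall X, (c X @: U <= U)%VS) ->
    U = 0%VS \/ U = fullv.

Definition e0 : G := (0, 1).

Definition vec (v : V) : G := (v, 0).

(* The basis vectors e_(i+1) of the x-factor and e_(k+i+1) of the z-factor. *)
Definition ex (i : 'I_k) : G := vec (col_mx (col_mx (delta_mx i 0) 0) 0).
Definition ez (i : 'I_k) : G := vec (col_mx 0 (delta_mx i 0)).

(* e_0 . prod_i 1/2 (e_i - e_(k+i)) . (e_i + e_(k+i)). *)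
Definition volume (c : G -> 'End(Sigma)) : 'End(Sigma) :=
  (c e0 \o
    \big[@comp_lfun _ Sigma Sigma Sigma / \1%VF]_(i < k)
       (2^-1 *: (c (ex i - ez i) \o c (ex i + ez i))))%VF.

(* A spinor is a map psi : G -> Sigma in the trivialization given by a
   left-invariant frame. A vector field is a map X : G -> G giving, at each
   point, its components in the Lie algebra in the same trivialization. *)

Definition lieD (a : R) (X : G -> G) (h : G -> R[i]) (p : G) : R[i] :=
  let w := linv a p (X p) in
  Complex ('D_w (fun q => complex.Re (h q)) p)
          ('D_w (fun q => complex.Im (h q)) p).

Definition spin_coord (h : 'I_(\dim {:Sigma})) (psi : G -> Sigma) (p : G) :
    R[i] :=
  coord (vbasis {:Sigma}) h (psi p).

Definition smooth_spinor (psi : G -> Sigma) : Prop :=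
  forall h, smooth (fun p => complex.Re (spin_coord h psi p) : R) /\
            smooth (fun p => complex.Im (spin_coord h psi p) : R).

Definition spin_connection (a : R) (g : G -> G -> R) (nabla : G -> G -> G)
    (c : G -> 'End(Sigma)) (X : G -> G) (psi : G -> Sigma) (p : G) : Sigma :=
  let u := vbasis {:Sigma} in
  let e := vbasis {:G} in
  \sum_h lieD a X (spin_coord h psi) p *: u`_h +
  4^-1 *: \sum_h \sum_j
    spin_coord h psi p *: c (sharp g (coord e j)) (c (nabla (X p) e`_j) u`_h).

Definition killing_spinor (a : R) (g : G -> G -> R) (nabla : G -> G -> G)
    (c : G -> 'End(Sigma)) (lambda : R[i]) (psi : G -> Sigma) : Prop :=
  [/\ lambda != 0,
      smooth_spinor psi,
      (exists p, psi p != 0) &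
      forall X : G -> G, smooth X -> forall p,
        spin_connection a g nabla c X psi p = lambda *: c (X p) (psi p)].

(* Sigma_f^+ for b = false and Sigma_f^- for b = true. *)
Definition Sigma_f (tau : R[i]) (c : G -> 'End(Sigma)) (b : bool) :
    set Sigma :=
  [set psi | (forall v : V, c (vec (fmx *m v)) psi = 0) /\
             psi = (-1) ^+ b * ('i%C * tau) *: c e0 psi].

(* + i tau a / 2 for b = false and - i tau a / 2 for b = true. *)
Definition killing_const (a : R) (tau : R[i]) (b : bool) : R[i] :=
  (-1) ^+ b * ('i%C * tau * (a / 2)%:C).

Definition scaled_spinor (a : R) (psi : Sigma) (p : G) : Sigma :=
  (expR (a * tcoord p / 2))%:C *: psi.

Definition has_dim (A : set Sigma) (d : nat) : Prop :=
  exists U : {vspace Sigma}, (forall psi, psi \in U <-> A psi) /\ \dim U = d.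

Definition sum_set (A B : set Sigma) : set Sigma :=
  [set x | exists u v, [/\ A u, B v & x = u + v]].

Definition lin_indep (N : nat) (Psi : 'I_N -> G -> Sigma) : Prop :=
  forall z : 'I_N -> R[i],
    (forall p, \sum_(i < N) z i *: Psi i p = 0) -> forall i, z i = 0.

(* The space A of left-invariant spinors yields, through the map
   psi |-> e^(a t / 2) psi, N linearly independent Killing spinors. *)
Definition yields_killing (a : R) (g : G -> G -> R) (nabla : G -> G -> G)
    (c : G -> 'End(Sigma)) (A : set Sigma) (lambda : R[i]) (N : nat) : Prop :=
  exists u : 'I_N -> Sigma,
    [/\ forall i, A (u i),
        lin_indep (fun i => scaled_spinor a (u i)) &
        forall i, killing_spinor a g nabla c lambda (scaled_spinor a (u i))].

End Spinors.

(* How many of the constants epsilon_0, delta_1, ..., delta_k are positive. *)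
Definition npos (R : realType) (k : nat) (delta : 'rV[R]_k) (tau : R[i]) : nat :=
  ((0 < eps0 tau)%R + \sum_(i < k) (0 < delta 0%R i)%R)%N.

Arguments e0 {R n k}.

(* Main.v *)
From HB Require Import structures.
Require Import Defs.
From mathcomp Require Import all_boot all_order all_algebra.
From mathcomp Require Import complex ring zify lra.
From mathcomp Require Import all_classical all_reals all_analysis.

(* The x- and z-directions act on Sigma as fermionic annihilation and creation
   operators, so the joint kernel of the image of f is an irreducible module
   over the remaining Clifford algebra, generated by e_0 and the y-directions:
   an invariant subspace W of ker P generates the invariant subspace W + Q W.
   Pairing the remaining generators into further annihilation-creation pairs
   gives its dimension. When n > 2k a y-direction anticommutes with e_0 and
   exchanges the two eigenspaces of i tau e_0, which thus have half this
   dimension; when n = 2k the joint kernel is a line, and the volume element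
   decides by which sign i tau e_0 acts on it.
   Nondegeneracy of the metric gives
     nabla_X Y = eps_0 (<e_0, Y> w - <w, Y> e_0),   w = phi_0 X,
   and contraction with the dual basis turns the spin connection into
   X + eps_0 / 2 e_0 . w, from which the Killing equation is immediate on
   e^(a t / 2) psi. *)

Set Implicit Arguments.
Unset Strict Implicit.
Unset Printing Implicit Defensive.
Import Order.TTheory GRing.Theory Num.Theory numFieldNormedType.Exports.

Local Open Scope classical_set_scope.
Local Open Scope ring_scope.
Local Open Scope complex_scope.

(** * Irreducible families of operators *)

Section IrreducibleSubspaces.
Variables (F : fieldType) (V : vectType F).
Implicit Types (U W : {vspace V}) (f g P Q : 'End(V)) (S : seq 'End(V)).

Definition stable S U := forall f, f \in S -> forall x, x \in U -> f x \in U.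

(** Irreducibility is relative to a subspace [U] of a fixed ambient space, so that passing to
    successive kernels needs no restricted operators. *)
Definition irreducible_on S U :=
  [/\ U != 0%VS, stable S U &
      forall W, (W <= U)%VS -> stable S W -> W = 0%VS \/ W = U].

Definition anticommute f g := forall x, f (g x) = - g (f x).

Lemma anticommuteC f g : anticommute f g -> anticommute g f.
Proof. by move=> fg x; rewrite fg opprK. Qed.

Lemma anticommuteZ (a b : F) f g :
  anticommute f g -> anticommute (a *: f) (b *: g).
Proof.
move=> fg x; rewrite !lfun_simp !linearZ /= fg !scalerN !scalerA.
by rewrite [b * a]mulrC.
Qed.

(** The canonical anticommutation relations of one fermionic mode. *)
Definition null_pair P Q :=
  [/\ forall x, P (P x) = 0, forall x, Q (Q x) = 0 &
      forall x, P (Q x) + Q (P x) = x].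

(** [P] maps [U] onto [U :&: lker P]: its image lies there because P^2 = 0, and x = P (Q x) whenever
    P x = 0. Rank-nullity then gives two equal halves. *)
Lemma null_pair_dim P Q U : null_pair P Q -> stable [:: P; Q] U ->
  \dim U = (2 * \dim (U :&: lker P))%N.
Proof.
move=> [PP QQ PQ] st.
rewrite mul2n -addnn -{1}(limg_ker_dim P U); congr (_ + \dim _)%N.
apply/eqP; rewrite eqEsubv; apply/andP; split; apply/subvP => x.
  move=> /memv_imgP [u uU ->]; rewrite memv_cap memv_ker PP eqxx andbT.
  by apply: st uU; rewrite inE eqxx.
rewrite memv_cap memv_ker => /andP [xU /eqP Px].
rewrite -(PQ x) Px linear0 addr0; apply: memv_img.
by apply: st xU; rewrite !inE eqxx orbT.
Qed.

(** For a stable [W] inside the kernel, [W + Q @: W] is stable under the larger family, hence 0 or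
    [U]. As P (y + Q w) = w for y, w in [W], intersecting this sum with the kernel of [P] gives back
    [W]. *)
Lemma null_pair_irreducible P Q S U : null_pair P Q ->
  {in S, forall f, anticommute f P} -> {in S, forall f, anticommute f Q} ->
  irreducible_on [:: P, Q & S] U -> irreducible_on S (U :&: lker P).
Proof.
move=> PQ0 SP SQ [U0 st irr]; have [PP QQ PQ] := PQ0.
have stP x : x \in U -> P x \in U by apply: st; rewrite inE eqxx.
have stQ x : x \in U -> Q x \in U by apply: st; rewrite !inE eqxx orbT.
have stS f x : f \in S -> x \in U -> f x \in U.
  by move=> fS; apply: st; rewrite !inE fS !orbT.
split.
- have /(null_pair_dim PQ0) dU : stable [:: P; Q] U.
    by move=> f; rewrite !inE => /orP[] /eqP ->.
  by apply: contraNneq U0 => K0; rewrite -dimv_eq0 dU K0 dimv0.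
- move=> f fS x; rewrite !memv_cap !memv_ker => /andP [xU /eqP Px].
  have := SP f fS x; rewrite Px linear0 => /esym/eqP.
  by rewrite oppr_eq0 => ->; rewrite stS.
move=> W /subvP WK stW.
have WU x : x \in W -> x \in U by move/WK; rewrite memv_cap => /andP[].
have WP x : x \in W -> P x = 0.
  by move/WK; rewrite memv_cap memv_ker => /andP[_ /eqP].
have PQW x : x \in W -> P (Q x) = x by move=> /WP Px; rewrite -{2}(PQ x) Px linear0 addr0.
have [||W0|WU'] := irr (W + Q @: W)%VS.
- rewrite subv_add; apply/andP; split; apply/subvP => x; first exact: WU.
  by move=> /memv_imgP [y yW ->]; apply/stQ/WU.
- move=> f fS x /memv_addP [y yW [z /memv_imgP [w wW ->] ->]]; rewrite linearD /=.
  move: fS; rewrite !inE => /or3P [/eqP->|/eqP->|fS].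
  + by rewrite WP // add0r PQW // (subvP (addvSl _ _)).
  + by rewrite QQ addr0 (subvP (addvSr _ _)) // memv_img.
  + rewrite SQ // -linearN; apply: memv_add; first exact: stW.
    by apply: memv_img; rewrite memvN; exact: stW.
- by left; apply/eqP; rewrite -subv0 -W0 addvSl.
- right; apply/eqP; rewrite eqEsubv; apply/andP; split; apply/subvP; first exact: WK.
  move=> x; rewrite memv_cap memv_ker -{1}WU' => /andP [].
  move=> /memv_addP [y yW [z /memv_imgP [w wW ->] ->]].
  by rewrite linearD /= WP // add0r PQW // => /eqP ->; rewrite linear0 addr0.
Qed.

(** Here f + g and f - g square to f^2 + g^2 = 0, and their anticommutator is 2 (f^2 - g^2) = 4,
    whence the factor 1/4. *)
Lemma null_pair_of_anticommuting f g : 2%:R != 0 :> F ->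
  (forall x, f (f x) = x) -> (forall x, g (g x) = - x) -> anticommute f g ->
  null_pair (f + g) (4%:R^-1 *: (f - g)).
Proof.
move=> two ff gg fg.
have four : 4%:R != 0 :> F by rewrite (natrM F 2 2) mulf_neq0.
have gf x : g (f x) = - f (g x) by rewrite fg opprK.
split=> x; rewrite !lfun_simp ?linearZ /= ?linearD ?linearN /= ?ff ?gg ?gf.
- by rewrite addrA addrK subrr.
- by rewrite !scalerN !opprK addrA subrK subrr.
rewrite !scalerN !opprK; set t := _ *: x; set u := _ *: f (g x).
rewrite [- u + t]addrC [u + t]addrC addrACA.
have -> : t - u + (t + u) = t *+ 2 by rewrite addrACA addNr addr0 mulr2n.
by rewrite -mulr2n -mulrnA -scaler_nat scalerA mulfV ?scale1r.
Qed.

Lemma eq_irreducible S T U : irreducible_on S U ->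
  (forall W, stable S W <-> stable T W) -> irreducible_on T U.
Proof.
move=> [U0 st irr] ST; split=> // [|W WU /ST]; first exact/ST.
exact: irr.
Qed.

Lemma stable_cat S T U : stable (S ++ T) U <-> stable S U /\ stable T U.
Proof.
split=> [st|[sS sT] f]; last by rewrite mem_cat => /orP[/sS|/sT].
by split=> f fS; apply: st; rewrite mem_cat fS ?orbT.
Qed.

Lemma stable_cons f S U :
  stable (f :: S) U <-> (forall x, x \in U -> f x \in U) /\ stable S U.
Proof.
split=> [st|[sf sS] g]; last by rewrite inE => /predU1P[->|/sS].
by split=> [|g gS]; apply: st; rewrite inE ?eqxx // gS orbT.
Qed.

(** The pairs are split off one at a time: the remaining pairs and [S] anticommute with the current
    pair, so they still act irreducibly on its kernel. *)
Lemma null_pairs_irreducible (I : eqType) (P Q : I -> 'End(V)) (s : seq I) S U :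
  uniq s -> (forall i, null_pair (P i) (Q i)) ->
  (forall i j, i != j -> [/\ anticommute (P i) (P j), anticommute (P i) (Q j),
     anticommute (Q i) (P j) & anticommute (Q i) (Q j)]) ->
  (forall i, {in S, forall f, anticommute f (P i) /\ anticommute f (Q i)}) ->
  irreducible_on (map P s ++ map Q s ++ S) U ->
  irreducible_on S (U :&: \bigcap_(i <- s) lker (P i)).
Proof.
move=> us PQ aPQ aS; elim: s us U => [|i s IH] /= us U irrU.
  by rewrite big_nil capvf.
rewrite big_cons capvA; case/andP: us => i_s us; apply: IH => //.
have aT f : f \in map P s ++ map Q s ++ S -> anticommute f (P i) /\ anticommute f (Q i).
  rewrite !mem_cat => /or3P [/mapP [j js ->]|/mapP [j js ->]|]; last exact: aS.
  - have /aPQ[] // : j != i by apply: contraNneq i_s => <-.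
  - have /aPQ[] // : j != i by apply: contraNneq i_s => <-.
apply: (@null_pair_irreducible _ (Q i)) => // [f fT|f fT|]; try by have [] := aT _ fT.
apply: eq_irreducible irrU _ => W.
by rewrite -cat_cons !(stable_cat, stable_cons); tauto.
Qed.

(** The image of f - 1 on [U] is the eigenspace of [f] for -1, and the injective [g] carries the
    eigenspace for 1 onto it. Rank-nullity for f - 1 concludes. *)
Lemma eigenspace_halves f g U : 2%:R != 0 :> F -> (forall x, f (f x) = x) ->
  (forall x, g (g x) = x) -> anticommute f g -> stable [:: f; g] U ->
  \dim U = (2 * \dim (U :&: lker (f - \1%VF)%R))%N.
Proof.
move=> two ff gg fg st.
have stf x : x \in U -> f x \in U by apply: st; rewrite inE eqxx.
have stg x : x \in U -> g x \in U by apply: st; rewrite !inE eqxx orbT.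
rewrite mul2n -addnn -{1}(limg_ker_dim (f - \1%VF)%R U); congr (_ + _)%N.
have kerP x : (x \in U :&: lker (f - \1%VF)%R)%VS = (x \in U) && (f x == x).
  by rewrite memv_cap memv_ker !lfun_simp subr_eq0.
have -> : ((f - \1%VF)%R @: U = g @: (U :&: lker (f - \1%VF)%R))%VS.
  apply/eqP; rewrite eqEsubv; apply/andP; split; apply/subvP => x.
    move=> /memv_imgP [u uU ->]; rewrite !lfun_simp -(gg (f u - u)).
    apply: memv_img; rewrite kerP; apply/andP; split.
      by apply/stg/rpredB => //; exact: stf.
    by rewrite fg linearB /= ff -linearN opprB.
  move=> /memv_imgP [u +  ->]; rewrite kerP => /andP [uU /eqP fu].
  (* Since f (g u) = - g u, the operator f - 1 multiplies g u by -2. *)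
  apply/memv_imgP; exists (- 2%:R^-1 *: g u).
    by rewrite memvZ // stg.
  rewrite linearZ /= !lfun_simp fg fu -opprD scalerN scaleNr opprK.
  by rewrite -mulr2n -scaler_nat scalerA mulVf // scale1r.
apply: limg_dim_eq; apply/eqP; rewrite -subv0; apply/subvP => x.
rewrite memv_cap memv_ker => /andP [_ /eqP gx].
by rewrite -(gg x) gx linear0 mem0v.
Qed.

End IrreducibleSubspaces.

(** * Irreducible modules over anticommuting involutions *)

Section OrthonormalSystems.
Variables (C : numClosedFieldType) (V : vectType C).

(** Two of the involutions combine into a null pair, whose kernel has half the dimension and is
    irreducible under the others. The induction ends with at most one involution, where [U] is a
    line. *)
Lemma orthonormal_irreducible_dim (J : eqType) (A : J -> 'End(V)) (s : seq J) U :
  uniq s -> (forall j x, A j (A j x) = x) ->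
  (forall i j, i != j -> anticommute (A i) (A j)) ->
  irreducible_on (map A s) U -> \dim U = (2 ^ (size s)./2)%N.
Proof.
move=> us AA aA.
have [m] := ubnP (size s).
elim: m s us U => // m IH s us U sm irrU.
have [U0 st irr] := irrU.
(* By irreducibility, a common eigenvector spans [U]. *)
have line v : v \in U -> v != 0 -> stable (map A s) <[v]>%VS -> \dim U = 1%N.
  move=> vU v0 /(irr <[v]>%VS)[]; first by rewrite -memvE.
    by move=> v_0; case/negP: v0; rewrite -memv0 -v_0 memv_line.
  by move=> <-; rewrite dim_vline v0.
case: s us sm irrU st irr line => [|j [|j' s]] us sm irrU st irr line.
- by apply: (line (vpick U)); rewrite ?memv_pick ?vpick0.
- pose u := vpick U; have uU : u \in U := memv_pick U.
  have stA x : x \in U -> A j x \in U by apply: st; rewrite inE eqxx.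
  (* Either u is an eigenvector for -1, or u + A j u is a nonzero eigenvector for 1. *)
  have [Au|v0] := eqVneq (u + A j u) 0.
    apply: (line u) => //; first by rewrite vpick0.
    move=> f; rewrite inE => /eqP -> x /vlineP [z ->]; rewrite linearZ /= memvZ //.
    by rewrite -(addKr u (A j u)) Au addr0 memvN memv_line.
  apply: (line (u + A j u)) => //; first by apply: rpredD => //; exact: stA.
  move=> f; rewrite inE => /eqP -> x /vlineP [z ->]; rewrite linearZ /= memvZ //.
  by rewrite linearD /= AA addrC memv_line.
have /= /andP [jn /andP [j'n us']] := us; move: jn; rewrite inE negb_or => /andP [jj' jn].
(* The factor i turns square 1 into square -1, as the construction of a null pair requires. *)
pose B := 'i *: A j'.
have BE x : B x = 'i *: A j' x by rewrite lfun_simp.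
have BB x : B (B x) = - x.
  by rewrite !BE linearZ /= AA scalerA -expr2 sqrCi scaleN1r.
have AB : anticommute (A j) B.
  by move=> x; rewrite !BE linearZ /= aA // scalerN.
have AjB i : i \in s -> anticommute (A i) (A j) /\ anticommute (A i) B.
  move=> i_s; split; first by apply: aA; apply: contraNneq jn => <-.
  move=> x; rewrite !BE linearZ /= aA ?scalerN //.
  by apply: contraNneq j'n => <-.
have two : 2%:R != 0 :> C by rewrite pnatr_eq0.
have PQ := null_pair_of_anticommuting two (AA j) BB AB.
set P := A j + B in PQ; set Q := 4%:R^-1 *: (A j - B) in PQ.
have PE x : P x = A j x + B x by rewrite lfun_simp.
have QE x : Q x = 4%:R^-1 *: (A j x - B x) by rewrite !lfun_simp.
(* The change from [A j], [A j'] to [P], [Q] is an invertible linear one, so the stable subspaces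
   are the same. *)
have stPQ W : stable (map A [:: j, j' & s]) W <-> stable [:: P, Q & map A s] W.
  rewrite /= !stable_cons; split=> [[sj [sj' sS]]|[sP [sQ sS]]].
    have sB x : x \in W -> B x \in W by move=> xW; rewrite BE memvZ // sj'.
    split=> [x xW|]; first by rewrite PE rpredD ?sj ?sB.
    by split=> // x xW; rewrite QE memvZ // rpredB ?sj ?sB.
  have QE4 x : 4%:R *: Q x = A j x - B x.
    by rewrite QE scalerA divff ?scale1r // pnatr_eq0.
  split=> [x xW|]; last split=> // x xW.
    have -> : A j x = 2%:R^-1 *: (P x + 4%:R *: Q x).
      rewrite QE4 PE addrACA subrr addr0 -mulr2n.
      by rewrite -[A j x *+ 2]scaler_nat scalerA mulVf ?scale1r.
    by rewrite memvZ // rpredD ?memvZ ?sP ?sQ.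
  have -> : A j' x = ('i^-1 * 2%:R^-1) *: (P x - 4%:R *: Q x).
    rewrite QE4 PE opprB addrC addrA subrK -mulr2n -[B x *+ 2]scaler_nat BE !scalerA.
    by rewrite -(mulrA 'i^-1) mulVf ?pnatr_eq0 // mulr1 mulVf ?scale1r ?neq0Ci.
  by rewrite memvZ // rpredB ?memvZ ?sP ?sQ.
have irrPQ := eq_irreducible irrU stPQ.
have [_ /stPQ/stable_cons[sP /stable_cons[sQ _]] _] := irrU.
rewrite (null_pair_dim PQ); last by rewrite !stable_cons.
rewrite (IH s) // ?expnS //; first by move: sm => /=; lia.
apply: null_pair_irreducible PQ _ _ irrPQ => f /mapP [i /AjB [ij iB] ->] x.
  by rewrite !PE linearD /= ij iB opprD.
by rewrite !QE linearZ /= linearB /= ij iB -scalerN opprB opprK addrC.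
Qed.

End OrthonormalSystems.

(** * The spinor module *)

Section CliffordModule.
Variables (R : realType) (n k : nat).
Local Notation G := (solv R n k).
Variables (delta : 'rV[R]_k) (eps : 'rV[R]_(n - k.*2)) (tau : R[i]).
Local Notation g := (metric delta eps tau).

(** * The metric in the adapted basis *)

Lemma metric_split (x x' z z' : 'cV[R]_k) (y y' : 'cV[R]_(n - k.*2)) (r r' : R) :
  g (col_mx (col_mx x y) z, r) (col_mx (col_mx x' y') z', r') =
  \sum_i delta 0 i * (x i 0 * z' i 0 + z i 0 * x' i 0) +
  \sum_j eps 0 j * (y j 0 * y' j 0) + eps0 tau * (r * r').
Proof.
have diagE m (d : 'rV[R]_m) (u v : 'cV[R]_m) :
    (u^T *m diag_mx d *m v) 0 0 = \sum_i d 0 i * (u i 0 * v i 0).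
  rewrite mxE; apply: eq_bigr => i _; rewrite mxE (bigD1 i) //= big1 => [|j ji].
    by rewrite !mxE eqxx mulr1n addr0 mulrCA mulrA.
  by rewrite !mxE (negbTE ji) mulr0n mulr0.
rewrite /metric /gmx /=; congr (_ + _).
rewrite !tr_col_mx mul_row_block mul_row_block.
rewrite !(mulmx0, add0r, addr0).
rewrite !mul_row_col !mul_mx_row !mulmx0 addr0 add_row_mx !addr0 add0r mul_row_col.
rewrite [LHS]mxE [in LHS]mxE !diagE.
rewrite addrAC -big_split /=; congr (_ + _); apply: eq_bigr => i _.
by rewrite mulrDr addrC.
Qed.

(** Together with [ex], [ez] and [e0] these form the adapted basis of the Lie algebra. *)
Definition ey (j : 'I_(n - k.*2)) : G := vec (col_mx (col_mx 0 (delta_mx j 0)) 0).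

Lemma metric_ex_ex i j : g (ex R n i) (ex R n j) = 0.
Proof.
by rewrite metric_split !big1 ?mul0r ?mulr0 ?addr0 // => l _; rewrite !mxE; ring.
Qed.

Lemma metric_ez_ez i j : g (ez R n i) (ez R n j) = 0.
Proof.
rewrite /ez -[0 : 'cV_(k + (n - k.*2))]col_mx0 metric_split.
by rewrite !big1 ?mul0r ?mulr0 ?addr0 // => l _; rewrite !mxE; ring.
Qed.

Lemma metric_ex_ez i j : g (ex R n i) (ez R n j) = (delta 0 i) *+ (i == j).
Proof.
rewrite /ez -[0 : 'cV_(k + (n - k.*2))]col_mx0 metric_split.
rewrite (bigD1 i) //= !big1 => [|l _|l li].
- by rewrite !mxE !eqxx /= mul0r !mulr0 !addr0 mul1r mulr_natr andbT.
- by rewrite !mxE; ring.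
- by rewrite !mxE (negbTE li) /=; ring.
Qed.

Lemma metric_ey_ey i j : g (ey i) (ey j) = (eps 0 i) *+ (i == j).
Proof.
rewrite metric_split (bigD1 i) //= !big1 => [|l li|l _].
- by rewrite !mxE !eqxx /= mul0r !mulr0 !addr0 mul1r mulr_natr andbT add0r.
- by rewrite !mxE (negbTE li) /=; ring.
- by rewrite !mxE; ring.
Qed.

Lemma metric_ex_ey i j : g (ex R n i) (ey j) = 0.
Proof.
by rewrite metric_split !big1 ?mul0r ?mulr0 ?addr0 // => l _; rewrite !mxE; ring.
Qed.

Lemma metric_ez_ey i j : g (ez R n i) (ey j) = 0.
Proof.
rewrite /ez -[0 : 'cV_(k + (n - k.*2))]col_mx0 metric_split.
by rewrite !big1 ?mul0r ?mulr0 ?addr0 // => l _; rewrite !mxE; ring.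
Qed.

Lemma metric_vec_e0 v : g (vec v) e0 = 0.
Proof. by rewrite /metric /= mulmx0 mxE mul0r mulr0 addr0. Qed.

Lemma metric_e0 : g e0 e0 = eps0 tau.
Proof. by rewrite /metric /= mulmx0 mxE !mulr1 add0r. Qed.

Lemma column_sum m (W : lmodType R) (h : 'cV[R]_m -> W) :
  (forall r x y, h (r *: x + y) = r *: h x + h y) ->
  forall x, h x = \sum_i x i 0 *: h (delta_mx i 0).
Proof.
move=> hl x.
have hD u v : h (u + v) = h u + h v.
  by rewrite -[u in LHS]scale1r hl scale1r.
have h0 : h 0 = 0 by apply: (addrI (h 0)); rewrite -hD !addr0.
rewrite [x in LHS]matrix_sum_delta (big_morph h hD h0); apply: eq_bigr => i _.
by rewrite big_ord1 -[_ *: _ in LHS]addr0 hl h0 addr0.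
Qed.

Lemma basis_decomposition (x z : 'cV[R]_k) (y : 'cV[R]_(n - k.*2)) (r : R) :
  (col_mx (col_mx x y) z, r) =
  \sum_i x i 0 *: ex R n i + \sum_j y j 0 *: ey j +
  \sum_i z i 0 *: ez R n i + r *: e0 :> G.
Proof.
have vecl s (u v : splitRn R n k) : vec (s *: u + v) = s *: vec u + vec v :> G.
  by congr (_, _); rewrite /= scaler0 addr0.
rewrite -(@column_sum _ _ (fun x => vec (col_mx (col_mx x 0) 0))); last first.
  by move=> s u v; rewrite -vecl !scale_col_mx !add_col_mx !scaler0 !addr0.
rewrite -(@column_sum _ _ (fun y => vec (col_mx (col_mx 0 y) 0))); last first.
  by move=> s u v; rewrite -vecl !scale_col_mx !add_col_mx !scaler0 !addr0.
rewrite -(@column_sum _ _ (fun z => vec (col_mx 0 z))); last first.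
  by move=> s u v; rewrite -vecl !scale_col_mx !add_col_mx !scaler0 !addr0.
congr (_, _) => /=.
  rewrite scaler0 addr0 !add_col_mx -[0 : 'cV_(k + _)]col_mx0 !add_col_mx.
  by rewrite !addr0 !add0r.
by rewrite !add0r /GRing.scale /= mulr1.
Qed.

Lemma splitRnP (v : splitRn R n k) :
  exists x y z, v = col_mx (col_mx x y) z.
Proof.
exists (usubmx (usubmx v)), (dsubmx (usubmx v)), (dsubmx v).
by rewrite !vsubmxK.
Qed.

(** * Clifford multiplication in the adapted basis *)

Variables (Sigma : vectType R[i]) (c : G -> 'End(Sigma)).
Hypothesis hc : clifford_rep g c.

Lemma rep_linear r X Y : c (r *: X + Y) = r%:C *: c X + c Y.
Proof. exact: hc.1. Qed.

Lemma repD X Y : c (X + Y) = c X + c Y.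
Proof. by rewrite -[X in LHS]scale1r rep_linear scale1r. Qed.

Lemma rep0 : c 0 = 0.
Proof. by apply: (addrI (c 0)); rewrite -repD !addr0. Qed.

Lemma repZ r X : c (r *: X) = r%:C *: c X.
Proof. by rewrite -[_ *: X]addr0 rep_linear rep0 addr0. Qed.

Lemma repB X Y : c (X - Y) = c X - c Y.
Proof. by rewrite addrC -scaleN1r rep_linear rmorphN1 scaleN1r addrC. Qed.

Lemma rep_sum I (s : seq I) (P : pred I) (X : I -> G) :
  c (\sum_(i <- s | P i) X i) = \sum_(i <- s | P i) c (X i).
Proof. exact: (big_morph c repD rep0). Qed.

Lemma rep_anticommute X Y : g X Y = 0 -> anticommute (c X) (c Y).
Proof.
move=> XY psi; apply/eqP; rewrite -subr_eq0 opprK; apply/eqP.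
by rewrite hc.2 XY mulr0 scale0r.
Qed.

Lemma rep_sqr X psi : c X (c X psi) = - (g X X)%:C *: psi.
Proof.
have /eqP := hc.2 X X psi; rewrite -mulr2n => /eqP h.
apply: (@scalerI _ _ (2%:R)); first by rewrite pnatr_eq0.
by rewrite scaler_nat h scalerA mulNr rmorphN rmorphM rmorph_nat mulrN.
Qed.

Lemma rep_basis (x z : 'cV[R]_k) (y : 'cV[R]_(n - k.*2)) (r : R) :
  c (col_mx (col_mx x y) z, r) =
  \sum_i (x i 0)%:C *: c (ex R n i) + \sum_j (y j 0)%:C *: c (ey j) +
  \sum_i (z i 0)%:C *: c (ez R n i) + r%:C *: c e0.
Proof.
by rewrite basis_decomposition !repD !rep_sum repZ;
  do ?congr (_ + _); apply: eq_bigr => i _; rewrite repZ.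
Qed.

Lemma fmx_split (x z : 'cV[R]_k) (y : 'cV[R]_(n - k.*2)) :
  fmx *m col_mx (col_mx x y) z = col_mx (col_mx z 0) 0.
Proof.
by rewrite /fmx mul_block_col !mul0mx add0r addr0 mul_col_mx mul1mx mul0mx.
Qed.

(** The image of [fmx] is the x-factor, so the conditions f(v) psi = 0 reduce to the basis vectors
    [ex]. The intersection runs over a list to match [null_pairs_irreducible]. *)
Definition joint_kernel : {vspace Sigma} :=
  \bigcap_(i <- enum 'I_k) lker (c (ex R n i)).

Lemma joint_kernelP psi :
  psi \in joint_kernel <-> forall v, c (vec (fmx *m v)) psi = 0.
Proof.
have capP : psi \in joint_kernel <-> forall i, c (ex R n i) psi = 0.
  rewrite /joint_kernel; split=> [h i|h].
    move: h; rewrite big_enum /= (bigD1 i) //= memv_cap memv_ker.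
    by case/andP => /eqP.
  apply: (big_ind (fun U : {vspace Sigma} => psi \in U)) => [|U W pU pW|i _].
    exact: memvf.
    by rewrite memv_cap pU.
  by rewrite memv_ker h.
rewrite capP; split=> [h v|h i].
  have [x [y [z ->]]] := splitRnP v.
  rewrite fmx_split /vec rep_basis scale0r addr0.
  rewrite [X in _ + X]big1 => [|j _]; last by rewrite mxE scale0r.
  rewrite addr0 [X in _ + X]big1 => [|j _]; last by rewrite mxE scale0r.
  by rewrite addr0 sum_lfunE big1 // => i _; rewrite lfun_simp h scaler0.
by have := h (col_mx (col_mx 0 0) (delta_mx i 0)); rewrite fmx_split.
Qed.

(** * Normalised generators and dimensions of the kernels *)

Hypothesis htau : tau = 1 \/ tau = 'i%C.
Hypothesis hdelta : forall i, delta 0 i = 1 \/ delta 0 i = -1.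
Hypothesis heps : forall i, eps 0 i = 1 \/ eps 0 i = -1.

Lemma eps0E : (eps0 tau)%:C = tau ^+ 2.
Proof.
case: htau => ->; rewrite /eps0 ?expr1n // sqr_i.
by rewrite -[-1 : R[i]](rmorphN1 (real_complex R)).
Qed.

Lemma eps0_sqr : eps0 tau ^+ 2 = 1.
Proof.
case: htau => ->; rewrite /eps0 ?expr1n // sqr_i /= ?expr1n //.
by rewrite sqrrN expr1n.
Qed.

Lemma delta_sqr i : delta 0 i * delta 0 i = 1.
Proof. by case: (hdelta i) => ->; rewrite ?mulrNN mulr1. Qed.

(** The anticommutator of [c (ex R n i)] and [c (ez R n i)] is -2 delta_i; the factor - delta_i / 2
    normalises it to 1. *)
Definition lower (i : 'I_k) : 'End(Sigma) :=
  (- (delta 0 i) / 2)%:C *: c (ez R n i).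

(** The scalars make every generator square to 1. The index [None] stands for [e0], and its operator
    i tau e_0 is the one defining [Sigma_f]; its square is tau^4 = 1. *)
Definition unit_rep (j : option 'I_(n - k.*2)) : 'End(Sigma) :=
  if j is Some j then (if eps 0 j == 1 then 'i%C else 1) *: c (ey j)
  else ('i%C * tau) *: c e0.

Lemma unit_rep_sqr j psi : unit_rep j (unit_rep j psi) = psi.
Proof.
case: j => [j|] /=; rewrite !lfun_simp linearZ scalerA -expr2 /= rep_sqr scalerA.
  rewrite metric_ey_ey eqxx mulr1n; case: eqP => [->|].
    by rewrite sqr_i mulrNN mulr1 scale1r.
  by case: (heps j) => -> // _; rewrite rmorphN opprK expr1n mulr1 scale1r.
rewrite metric_e0 eps0E exprMn sqr_i mulN1r mulrNN -exprD.
by case: htau => ->; rewrite ?expr1n ?(exprM _ 2 2) ?sqr_i ?sqrrN ?expr1n scale1r.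
Qed.

Lemma unit_rep_anticommute i j : i != j -> anticommute (unit_rep i) (unit_rep j).
Proof.
case: i j => [i|] [j|] //= ij; apply: anticommuteZ.
- apply: rep_anticommute; rewrite metric_ey_ey (_ : i == j = false) //.
  by apply: contraNF ij => /eqP ->.
- exact/rep_anticommute/metric_vec_e0.
- exact/anticommuteC/rep_anticommute/metric_vec_e0.
Qed.

Lemma unit_rep_ex j i : anticommute (unit_rep j) (c (ex R n i)).
Proof.
rewrite -[c (ex R n i)]scale1r.
case: j => [j|] /=; apply/anticommuteZ/anticommuteC/rep_anticommute.
  exact: metric_ex_ey.
exact: metric_vec_e0.
Qed.

Lemma unit_rep_lower j i : anticommute (unit_rep j) (lower i).
Proof.
case: j => [j|] /=; apply/anticommuteZ/anticommuteC/rep_anticommute.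
  exact: metric_ez_ey.
exact: metric_vec_e0.
Qed.

Lemma ex_lower_null_pair i : null_pair (c (ex R n i)) (lower i).
Proof.
split=> x.
- by rewrite rep_sqr metric_ex_ex oppr0 scale0r.
- by rewrite !lfun_simp linearZ /= rep_sqr metric_ez_ez oppr0 scale0r !scaler0.
- rewrite !lfun_simp linearZ /= -scalerDr hc.2 metric_ex_ez eqxx mulr1n scalerA.
  rewrite -rmorphM /= (_ : _ / 2 * _ = delta 0 i * delta 0 i); last by field.
  by rewrite delta_sqr scale1r.
Qed.

Definition unit_indices : seq (option 'I_(n - k.*2)) :=
  None :: map Some (enum 'I_(n - k.*2)).

Lemma unit_indices_uniq : uniq unit_indices.
Proof.
rewrite /= map_inj_uniq ?enum_uniq ?andbT; last by move=> ? ? [].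
by apply/mapP => -[].
Qed.

(** Splitting off the k null pairs [c (ex R n i)], [lower i] from the full space leaves exactly the
    operators [unit_rep]. *)
Lemma joint_kernel_irreducible : irreducible_rep c ->
  irreducible_on (map unit_rep unit_indices) joint_kernel.
Proof.
move=> [dim0 irr]; rewrite -[joint_kernel]capfv.
apply: (@null_pairs_irreducible _ _ _ _ lower (enum 'I_k)).
- exact: enum_uniq.
- exact: ex_lower_null_pair.
- move=> i j ij; rewrite -[c (ex R n i)]scale1r -[c (ex R n j)]scale1r.
  split; apply/anticommuteZ; try apply: rep_anticommute.
  + exact: metric_ex_ex.
  + by rewrite metric_ex_ez (negbTE ij).
  + by rewrite metricC metric_ex_ez eq_sym (negbTE ij).
  + exact: metric_ez_ez.
- move=> i f /mapP [j _ ->]; split; [exact: unit_rep_ex|exact: unit_rep_lower].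
split.
- by rewrite -dimv_eq0.
- by move=> f _ x _; exact: memvf.
(* The normalising scalars are invertible, so stability under the rescaled generators gives
   stability under every [c X]. *)
move=> W _ /stable_cat [stE /stable_cat [stL stU]]; apply: irr => X.
have stX i x : x \in W -> c (ex R n i) x \in W.
  by apply: stE; apply: map_f; rewrite mem_enum.
have stZ i x : x \in W -> c (ez R n i) x \in W.
  move=> /(stL (lower i)); rewrite map_f ?mem_enum // => /(_ isT).
  rewrite lfun_simp => /(memvZ (- 2 * delta 0 i)%:C).
  rewrite scalerA -rmorphM /= (_ : _ * (_ / 2) = delta 0 i * delta 0 i); last by field.
  by rewrite delta_sqr scale1r.
have stY j x : x \in W -> c (ey j) x \in W.
  move=> /(stU (unit_rep (Some j))); rewrite map_f => [|]; last first.
    by rewrite inE map_f ?mem_enum.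
  move=> /(_ isT); rewrite /= lfun_simp; set z := if _ then _ else _.
  move=> /(memvZ z^-1); rewrite scalerA mulVf ?scale1r // /z.
  by case: ifP; rewrite ?oner_neq0 // eq_complex /= oner_eq0 andbF.
have stT x : x \in W -> c e0 x \in W.
  move=> /(stU (unit_rep None)); rewrite map_f ?inE ?eqxx // => /(_ isT).
  rewrite /= lfun_simp => /(memvZ ('i%C * tau)^-1); rewrite scalerA mulVf ?scale1r //.
  have i0 : ('i%C : R[i]) != 0 by rewrite eq_complex /= oner_eq0 andbF.
  by case: htau => ->; rewrite mulf_neq0 ?oner_neq0.
case: X => v r; have [x [y [z ->]]] := splitRnP v.
apply/subvP => w /memv_imgP [u uW ->].
rewrite rep_basis !lfun_simp ?sum_lfunE; do ?apply: rpredD; try apply: rpred_sum => i _;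
  rewrite ?lfun_simp ?memvZ ?stX ?stY ?stZ ?stT //.
Qed.

Lemma dim_joint_kernel : irreducible_rep c ->
  \dim joint_kernel = (2 ^ (n - k.*2).+1./2)%N.
Proof.
move=> /joint_kernel_irreducible irr.
rewrite (orthonormal_irreducible_dim unit_indices_uniq unit_rep_sqr
           unit_rep_anticommute irr).
by rewrite /= size_map -cardE card_ord.
Qed.

(** The sign is put into the involution instead of the eigenvalue, so both cases are fixed spaces as
    in [eigenspace_halves]. *)
Definition signed_kernel (b : bool) : {vspace Sigma} :=
  joint_kernel :&: lker ((-1) ^+ b *: unit_rep None - \1%VF)%R.

Lemma signed_kernelP b psi : psi \in signed_kernel b <-> Sigma_f tau c b psi.
Proof.
rewrite memv_cap memv_ker !lfun_simp subr_eq0 scalerA; split.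
  by move=> /andP [/joint_kernelP h /eqP].
by move=> [/joint_kernelP -> h]; rewrite eq_sym; apply/eqP.
Qed.

Lemma dim_signed_kernel b : irreducible_rep c -> (k.*2 < n)%N ->
  \dim (signed_kernel b) = (2 ^ ((n - 1)./2 - k))%N.
Proof.
move=> irr kn.
have nk0 : (0 < n - k.*2)%N by rewrite subn_gt0.
(* A y-direction exists because 2k < n; it supplies the involution exchanging the two
   eigenspaces. *)
pose j := Some (Ordinal nk0).
have [_ st _] := joint_kernel_irreducible irr.
have stj i x : i \in unit_indices -> x \in joint_kernel -> unit_rep i x \in joint_kernel.
  by move=> iu; apply: st; apply: map_f.
have js : j \in unit_indices by rewrite inE map_f ?mem_enum.
have ns : None \in unit_indices by rewrite inE eqxx.
have two : 2%:R != 0 :> R[i] by rewrite pnatr_eq0.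
pose f := (-1) ^+ b *: unit_rep None.
have fE x : f x = (-1) ^+ b *: unit_rep None x by rewrite scale_lfunE.
have ff x : f (f x) = x.
  have := unit_rep_sqr None x; rewrite !fE; move: (unit_rep None) => u uu.
  rewrite linearZ /= uu scalerA -expr2.
  by rewrite -exprM mulnC exprM sqrrN expr1n expr1n scale1r.
have fj : anticommute f (unit_rep j).
  by rewrite -[unit_rep j]scale1r; apply/anticommuteZ/unit_rep_anticommute.
have stK : stable [:: f; unit_rep j] joint_kernel.
  move=> h; rewrite !inE => /orP [] /eqP -> x xK; last exact: stj.
  by rewrite fE memvZ // stj.
have := eigenspace_halves two ff (unit_rep_sqr j) fj stK.
rewrite dim_joint_kernel // -/(signed_kernel b).
(* By 2k < n, the truncated subtraction on the right is a true one. *)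
rewrite (_ : (n - k.*2).+1./2 = ((n - 1)./2 - k).+1) ?expnS; last by lia.
by move/eqP; rewrite eqn_pmul2l // => /eqP.
Qed.

End CliffordModule.

(** * The volume element *)

Arguments unit_rep : simpl never.

Section VolumeElement.
Variables (R : realType) (n k : nat).
Local Notation G := (solv R n k).
Variables (delta : 'rV[R]_k) (eps : 'rV[R]_(n - k.*2)) (tau : R[i]).
Local Notation g := (metric delta eps tau).
Variables (Sigma : vectType R[i]) (c : G -> 'End(Sigma)).
Hypothesis hc : clifford_rep g c.
Hypothesis htau : tau = 1 \/ tau = 'i%C.
Hypothesis hdelta : forall i, delta 0 i = 1 \/ delta 0 i = -1.
Hypothesis heps : forall i, eps 0 i = 1 \/ eps 0 i = -1.

(** As e_i kills psi and e_(k+i) squares to 0, each factor of the product reduces to 1/2 e_i e_(k+i)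
    psi = - delta_i psi. *)
Lemma volume_joint_kernel psi : psi \in joint_kernel c ->
  volume c psi = (\prod_i - delta 0 i)%:C *: c e0 psi.
Proof.
move=> /(joint_kernelP hc) kpsi; rewrite /volume comp_lfunE.
rewrite [X in c e0 X](_ : _ = (\prod_i - delta 0 i)%:C *: psi) ?linearZ //.
rewrite rmorph_prod; apply: (big_ind2 (fun (T : 'End(Sigma)) z => T psi = z *: psi)).
- by rewrite id_lfunE scale1r.
- by move=> T1 z1 T2 z2 h1 h2; rewrite comp_lfunE h2 linearZ /= h1 scalerA mulrC.
move=> i _; rewrite scale_lfunE comp_lfunE (repB hc) (repD hc) !lfun_simp.
have ex0 : c (ex R n i) psi = 0.
  by have := kpsi (col_mx (col_mx 0 0) (delta_mx i 0)); rewrite fmx_split.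
have := hc.2 (ex R n i) (ez R n i) psi; rewrite ex0 linear0 addr0 add0r => ->.
rewrite (rep_sqr hc) metric_ez_ez metric_ex_ez eqxx mulr1n oppr0 scale0r subr0.
by rewrite scalerA !rmorphM !rmorphN rmorph_nat mulNr mulrN mulKf ?pnatr_eq0.
Qed.

(** For a sign x, the number - x is -1 exactly when x is positive; this is applied to epsilon_0 =
    tau^2 and to each delta_i. *)
Lemma signs_npos : - tau ^+ 2 * (\prod_i - delta 0 i)%:C = (-1) ^+ npos delta tau.
Proof.
have negE (x : R) : x = 1 \/ x = -1 -> - x = (-1) ^+ (0 < x)%R.
  by case=> ->; rewrite ?ltr01 // oppr_gt0 ltr10 opprK.
have e0 : eps0 tau = 1 \/ eps0 tau = -1.
  by have /eqP := eps0_sqr htau; rewrite sqrf_eq1 => /orP [] /eqP ->; [left|right].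
rewrite -(eps0E htau) -rmorphN -rmorphM negE //.
under eq_bigr => i _ do rewrite negE //.
by rewrite -expr_sum -exprD rmorphXn rmorphN1.
Qed.

(** On the joint kernel the volume element is a sign times e_0, so its scalar value fixes that of i
    tau e_0. The exponent [m] covers both normalisations of the volume element. *)
Lemma signed_kernel_volume (m : nat) :
  (forall psi, volume c psi = (-1) ^+ m * ('i%C * tau) *: psi) ->
  joint_kernel c = signed_kernel eps tau c (odd (m + npos delta tau)).
Proof.
move=> vol; apply/eqP; rewrite eqEsubv capvSl andbT; apply/subvP => psi kpsi.
rewrite memv_cap kpsi memv_ker !lfun_simp subr_eq0 scalerA; apply/eqP.
set z := (\prod_i - delta 0 i)%:C.
have z2 : z * z = 1.
  rewrite -rmorphM -big_split /= big1 // => i _.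
  by rewrite mulrNN delta_sqr.
have e0E : c e0 psi = z *: volume c psi.
  by rewrite (volume_joint_kernel kpsi) scalerA z2 scale1r.
rewrite e0E vol !scalerA signr_odd -[RHS]scale1r; congr (_ *: _).
(* The two factors i tau, one from the involution and one from the volume element, multiply to -
   tau^2. *)
transitivity ((-1) ^+ (m + npos delta tau) * (-1) ^+ m * (- tau ^+ 2 * z) : R[i]).
  have -> : - tau ^+ 2 = 'i%C ^+ 2 * tau ^+ 2 by rewrite sqr_i mulN1r.
  move: ((-1) ^+ m) ((-1) ^+ (m + _)) => A B; ring.
rewrite signs_npos; move: (npos _ _) => p.
by rewrite -!exprD -signr_odd !oddD; case: (odd m); case: (odd p).
Qed.

(** For n = 2k the exponent of i is 2 (k^2 + 2k) + 1, and k^2 + 2k has the parity of k. *)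
Lemma orientation_scalar : n = k.*2 ->
  tau * 'i%C ^+ (k + (n.+1 * n.+2)./2) = (-1) ^+ k * ('i%C * tau).
Proof.
move=> ->.
rewrite (_ : (k + _)%N = (2 * (k * k + k + k)).+1)%N; last by nia.
rewrite exprS exprM sqr_i -(signr_odd _ (k * k + k + k)) !oddD addbK.
by rewrite oddM andbb signr_odd mulrA mulrC [tau * _]mulrC.
Qed.

(** The involution i tau e_0 preserves the joint kernel, so psi is the sum of its two
    eigencomponents (psi + w) / 2 and (psi - w) / 2, with w the image of psi. *)
Lemma sum_signed_kernels psi : irreducible_rep c ->
  psi \in joint_kernel c <->
  sum_set (Sigma_f tau c false) (Sigma_f tau c true) psi.
Proof.
move=> irr; have SP := signed_kernelP hc.
split=> [kpsi|[u [v [/SP + /SP + ->]]]]; last first.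
  by rewrite !memv_cap => /andP [uK _] /andP [vK _]; exact: rpredD.
have [_ st _] := joint_kernel_irreducible hc htau hdelta irr.
pose w := unit_rep eps tau c None psi.
have wK : w \in joint_kernel c := st _ (map_f (unit_rep eps tau c) (mem_head _ _)) _ kpsi.
have ww : unit_rep eps tau c None w = psi := unit_rep_sqr hc htau heps None psi.
exists (2^-1 *: (psi + w)), (2^-1 *: (psi - w)); split.
- apply/SP; rewrite memv_cap memvZ ?rpredD // memv_ker.
  rewrite add_lfunE opp_lfunE id_lfunE scale_lfunE scale1r linearZ linearD /= ww -/w.
  by rewrite [w + _]addrC subrr.
- apply/SP; rewrite memv_cap memvZ ?rpredB // memv_ker.
  rewrite add_lfunE opp_lfunE id_lfunE scale_lfunE scaleN1r linearZ linearB /= ww -/w.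
  by rewrite -scalerN opprB subrr.
rewrite -scalerDr addrACA subrr addr0 -mulr2n -[psi *+ 2]scaler_nat scalerA.
by rewrite mulVf ?scale1r // pnatr_eq0.
Qed.

Lemma signed_kernels_disjoint :
  Sigma_f tau c false `&` Sigma_f tau c true = [set 0].
Proof.
apply/seteqP; split=> psi; last first.
  by move=> ->; split; split => [v|]; rewrite ?linear0 ?scaler0.
move=> [[_ h1] [_ h2]] /=.
have hN : psi = - psi.
  by rewrite [LHS]h2 [in RHS]h1 expr1 mulN1r scaleNr expr0 mul1r.
apply: (@scalerI _ _ (2%:R : R[i])); first by rewrite pnatr_eq0.
by rewrite scaler0 scaler_nat mulr2n {2}hN subrr.
Qed.

End VolumeElement.

(** * Killing spinors *)

Section ExponentialSmooth.
Variables (R : realType) (n k : nat) (a : R).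
Local Notation G := (solv R n k).

Lemma is_diff_tcoord (p : G) : is_diff p (@tcoord R n k) (@tcoord R n k).
Proof.
have snd_lin : linear (@tcoord R n k) by [].
pose sndlM := GRing.isLinear.Build _ _ _ _ _ snd_lin.
pose sndL : {linear _ -> _} := HB.pack (@tcoord R n k) sndlM.
have sndC : continuous sndL by move=> q; exact: cvg_snd.
rewrite (_ : @tcoord R n k = sndL) //.
by apply: DiffDef; [exact: linear_differentiable|rewrite diff_lin].
Qed.

Lemma is_diff_expR (x : R) : is_diff x expR (fun h => h * expR x).
Proof.
have dexp : differentiable (expR : R -> R) x by exact/derivable1_diffP/derivable_expR.
apply: DiffDef => //; apply/funext => h.
rewrite -[h in LHS]mulr1 linearZ /= -deriveE //.
by rewrite (@derive_val _ _ _ _ _ _ _ (is_derive_expR x)).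
Qed.

Lemma is_diff_exp_tcoord (r : R) (p : G) :
  is_diff p (fun q : G => expR (a * tcoord q / 2) * r)
    (fun w => expR (a * tcoord p / 2) * (a / 2 * w.2 * r)).
Proof.
have d1 : is_diff p ((a / 2) *: @tcoord R n k) ((a / 2) *: @tcoord R n k).
  exact/is_diffZ/is_diff_tcoord.
have d2 := is_diffZ r (is_diff_comp d1 (is_diff_expR _)).
rewrite (_ : (fun q => _) = r *: (expR \o ((a / 2) *: @tcoord R n k))); last first.
  apply/funext => q; rewrite !fctE /= [RHS]mulrC; congr (expR _ * _).
  by rewrite /GRing.scale /= mulrAC.
apply: is_diff_eq; apply/funext => w; rewrite !fctE /=.
rewrite (_ : a * tcoord p / 2 = (a / 2) *: tcoord p); last by rewrite mulrAC.
rewrite /tcoord /GRing.scale /=; ring.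
Qed.

Lemma derive_exp_tcoord (r : R) (p w : G) :
  'D_w (fun q : G => expR (a * tcoord q / 2) * r) p =
  expR (a * tcoord p / 2) * (a / 2 * w.2 * r).
Proof.
have d := is_diff_exp_tcoord r p.
by rewrite deriveE ?diff_val.
Qed.

(** A directional derivative has the same form with another constant [r], so the induction on the
    order keeps [r] general. *)
Lemma smooth_exp_tcoord (r : R) : smooth (fun q : G => expR (a * tcoord q / 2) * r).
Proof.
move=> m; elim: m r => [|m IH] r /=.
  move=> p; apply: differentiable_continuous.
  by have d := is_diff_exp_tcoord r p.
split=> [p|v]; first by have d := is_diff_exp_tcoord r p.
under eq_fun do rewrite derive_exp_tcoord.
exact: IH.
Qed.

End ExponentialSmooth.

(** * The Levi-Civita connection, the spin connection and the Killing equation *)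

Section SpinConnection.
Variables (R : realType) (n k : nat).
Local Notation G := (solv R n k).
Variables (a : R) (delta : 'rV[R]_k) (eps : 'rV[R]_(n - k.*2)) (tau : R[i]).
Local Notation g := (metric delta eps tau).
Local Notation e := (vbasis {:G}).
Hypothesis htau : tau = 1 \/ tau = 'i%C.
Hypothesis hdelta : forall i, delta 0 i = 1 \/ delta 0 i = -1.
Hypothesis heps : forall i, eps 0 i = 1 \/ eps 0 i = -1.

Lemma metric_linear (X Y Z : G) (r : R) : g (r *: X + Y) Z = r * g X Z + g Y Z.
Proof.
by rewrite /metric /= bil_linl /GRing.scale /=; ring.
Qed.

Lemma metricD (X Y Z : G) : g (X + Y) Z = g X Z + g Y Z.
Proof. by rewrite -[X in LHS]scale1r metric_linear mul1r. Qed.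

Lemma metric0 (Z : G) : g 0 Z = 0.
Proof. by apply: (addrI (g 0 Z)); rewrite -metricD !addr0. Qed.

Lemma metricZ (X Z : G) (r : R) : g (r *: X) Z = r * g X Z.
Proof. by rewrite -[_ *: X]addr0 metric_linear metric0 addr0. Qed.

Lemma metricB (X Y Z : G) : g (X - Y) Z = g X Z - g Y Z.
Proof. by rewrite addrC -scaleN1r metric_linear mulN1r addrC. Qed.

Lemma metric_sum (I : finType) (X : I -> G) Z : g (\sum_i X i) Z = \sum_i g (X i) Z.
Proof. exact: (big_morph (g^~ Z) (fun X Y => metricD X Y Z) (metric0 Z)). Qed.

(** The x- and z-factors are dual to each other up to signs: pairing with [ez] reads off x, and
    pairing with [ex] reads off z. *)
Lemma metric_nondegenerate (X : G) : (forall Y, g X Y = 0) -> X = 0.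
Proof.
move=> h; case: X h => v r; have [x [y [z ->]]] := splitRnP v => h.
have x0 : x = 0.
  apply/colP => i; have := h (ez R n i); rewrite /ez -[0 : 'cV_(k + _)]col_mx0.
  rewrite metric_split (bigD1 i) //= !big1 => [|j _|j ji].
  - rewrite !mxE !eqxx /= => /(congr1 (fun t => delta 0 i * t)).
    by rewrite !mulr0 !addr0 mulr1 mulrA delta_sqr // mul1r.
  - by rewrite !mxE !mulr0.
  - by rewrite !mxE (negbTE ji) /= !mulr0 addr0 mulr0.
have z0 : z = 0.
  apply/colP => i; have := h (ex R n i).
  rewrite metric_split (bigD1 i) //= !big1 => [|j _|j ji].
  - rewrite !mxE !eqxx /= => /(congr1 (fun t => delta 0 i * t)).
    by rewrite !mulr0 !addr0 add0r mulr1 mulrA delta_sqr // mul1r.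
  - by rewrite !mxE !mulr0.
  - by rewrite !mxE (negbTE ji) /= !mulr0 addr0 mulr0.
have y0 : y = 0.
  apply/colP => i; have := h (ey R i).
  rewrite metric_split (bigD1 i) //= !big1 => [|j ji|j _].
  - rewrite !mxE !eqxx /= => /(congr1 (fun t => eps 0 i * t)).
    rewrite !mulr0 !addr0 add0r mulr1 mulrA.
    by case: (heps i) => ->; rewrite ?mulrNN !mul1r.
  - by rewrite !mxE (negbTE ji) /= !mulr0.
  - by rewrite !mxE !mulr0 addr0 mulr0.
have r0 : r = 0.
  have := h e0; rewrite /metric /= mulmx0 mxE add0r mulr1.
  move=> /(congr1 (fun t => eps0 tau * t)).
  by rewrite mulrA -expr2 (eps0_sqr htau) mul1r mulr0.
by rewrite x0 y0 z0 r0 !col_mx0.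
Qed.

(** The difference of the connections, paired with a third vector, is symmetric in its first two
    arguments and antisymmetric in the last two, hence zero. *)
Lemma levi_civita_unique (br nabla nabla' : G -> G -> G) :
  is_levi_civita g br nabla -> is_levi_civita g br nabla' ->
  forall X Y, nabla X Y = nabla' X Y.
Proof.
move=> [_ _ tf mt] [_ _ tf' mt'] X Y; apply/eqP; rewrite -subr_eq0; apply/eqP.
apply: metric_nondegenerate => Z.
pose T U V W := g (nabla U V - nabla' U V) W.
have TC U V W : T U V W = T V U W.
  rewrite /T -[nabla U V](subrK (nabla V U)) -[nabla' U V](subrK (nabla' V U)).
  by rewrite tf tf' opprD addrACA subrr add0r.
have TN U V W : T U V W = - T U W V.
  have := mt U V W; have := mt' U V W.
  by rewrite /T !metricB ![g V _]metricC; lra.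
have : T X Y Z = - T X Y Z.
  (* Six alternating swaps return to the starting order, and three of them change the sign. *)
  by rewrite [LHS]TN [T X Z Y]TC [T Z X Y]TN [T Z Y X]TC [T Y Z X]TN [T Y X Z]TC opprK.
by rewrite /T; lra.
Qed.

Lemma sharpP (alpha : G -> R) :
  (forall (r : R) X Y, alpha (r *: X + Y) = r * alpha X + alpha Y) ->
  forall Y, g (sharp g alpha) Y = alpha Y.
Proof.
move=> al; rewrite /sharp.
have aD X Z : alpha (X + Z) = alpha X + alpha Z.
  by rewrite -[X in LHS]scale1r al mul1r.
have a0 : alpha 0 = 0 by apply: (addrI (alpha 0)); rewrite -aD !addr0.
have aZ r X : alpha (r *: X) = r * alpha X.
  by rewrite -[_ *: X]addr0 al a0 addr0.
apply: (@xgetPex _ 0 [set X | forall Y, g X Y = alpha Y]).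
(* The metric matrix in the adapted basis is its own inverse, so the dual vector has the values of
   [alpha] as coordinates, up to signs and with [ex] and [ez] exchanged. Its existence rules out the
   default value 0 of [xget]. *)
exists (col_mx (col_mx (\col_i (delta 0 i * alpha (ez R n i)))
                       (\col_j (eps 0 j * alpha (ey R j))))
               (\col_i (delta 0 i * alpha (ex R n i))), eps0 tau * alpha e0).
case=> v r; have [x [y [z ->]]] := splitRnP v.
rewrite metric_split basis_decomposition !aD aZ !(big_morph alpha aD a0).
congr (_ + _); last by rewrite -mulrA mulrA -expr2 (eps0_sqr htau) mul1r mulrC.
rewrite addrAC -big_split /=; congr (_ + _); apply: eq_bigr => i _; rewrite !aZ !mxE.
  rewrite mulrDr -!mulrA !(mulrA (delta 0 i) (delta 0 i)) delta_sqr // !mul1r.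
  by rewrite addrC [_ * x i 0]mulrC [_ * z i 0]mulrC.
by case: (heps i) => ->; ring.
Qed.

(** Lowering the index of v and raising it again: paired with any Y, both sides give g v Y. *)
Lemma sharp_coord_sum (v : G) : \sum_(j < \dim {:G}) g v e`_j *: sharp g (coord e j) = v.
Proof.
apply/eqP; rewrite -subr_eq0; apply/eqP/metric_nondegenerate => Y.
rewrite metricB metric_sum.
under eq_bigr => j _.
  rewrite metricZ sharpP; last by move=> r X Z; rewrite linearP.
  over.
rewrite [Y in g v Y](coord_vbasis (memvf Y)) [g v _]metricC metric_sum.
apply/eqP; rewrite subr_eq0; apply/eqP; apply: eq_bigr => j _.
by rewrite metricZ metricC mulrC.
Qed.

(** The skew endomorphism attached to epsilon_0 times the bivector of e_0 and w, expressed by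
    pairings with [Y] so that a sum over the dual basis contracts it. *)
Definition koszul (X Y : G) : G :=
  let w := phi0 n k a *m X.1 in
  (eps0 tau * g e0 Y) *: vec w - (eps0 tau * g (vec w) Y) *: e0.

Lemma nabla_koszul (nabla : G -> G -> G) :
  is_levi_civita g (bracket a) nabla -> forall X Y, nabla X Y = koszul X Y.
Proof.
move=> lc X Y.
rewrite (levi_civita_unique lc (levi_civita_exists a delta eps (eps0_sqr htau))).
rewrite /koszul; congr (_, _) => /=.
  rewrite scaler0 subr0 /metric /= trmx0 !mul0mx mxE add0r mul1r.
  by rewrite mulrA -expr2 (eps0_sqr htau) mul1r.
rewrite scaler0 add0r /GRing.scale /= mulr1 /metric /= mul0r mulr0 addr0.
by rewrite mulNr.
Qed.

Variables (Sigma : vectType R[i]) (c : G -> 'End(Sigma)).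
Hypothesis hc : clifford_rep g c.

Lemma rep_sharp_sum (v : G) phi :
  \sum_(j < \dim {:G}) (g v e`_j)%:C *: c (sharp g (coord e j)) phi = c v phi.
Proof.
rewrite -[in RHS](sharp_coord_sum v) (rep_sum hc) sum_lfunE.
by apply: eq_bigr => j _; rewrite (repZ hc) scale_lfunE.
Qed.

(** The contraction yields epsilon_0 (e_0 w - w e_0), and the orthogonality of e_0 and w makes this
    2 epsilon_0 e_0 w. *)
Lemma clifford_connection_sum (X : G) psi :
  \sum_j c (sharp g (coord e j)) (c (koszul X e`_j) psi) =
  (2 * eps0 tau)%:C *: c e0 (c (vec (phi0 n k a *m X.1)) psi).
Proof.
rewrite /koszul; set w := vec _.
have wC : c w (c e0 psi) = - c e0 (c w psi).
  exact: (rep_anticommute hc (metric_vec_e0 _ _ _ _)).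
transitivity ((eps0 tau)%:C *: (c e0 (c w psi) - c w (c e0 psi))).
  rewrite -[c e0 (c w psi)]rep_sharp_sum -[c w (c e0 psi)]rep_sharp_sum.
  rewrite -sumrB scaler_sumr; apply: eq_bigr => j _.
  rewrite (repB hc) !(repZ hc) add_lfunE opp_lfunE !scale_lfunE linearB !linearZ /=.
  by rewrite scalerDr !scalerA -!rmorphM.
by rewrite wC opprK -mulr2n -scaler_nat scalerA rmorphM rmorph_nat mulrC.
Qed.

Lemma spin_connectionE (nabla : G -> G -> G) (X : G -> G) psi p :
  is_levi_civita g (bracket a) nabla ->
  spin_connection a g nabla c X psi p =
  \sum_h lieD a X (spin_coord h psi) p *: (vbasis {:Sigma})`_h +
  (eps0 tau / 2)%:C *: c e0 (c (vec (phi0 n k a *m (X p).1)) (psi p)).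
Proof.
move=> lc; rewrite /spin_connection; congr (_ + _).
rewrite exchange_big /=.
transitivity (4^-1 *: \sum_j c (sharp g (coord e j)) (c (koszul (X p) e`_j) (psi p))).
  congr (_ *: _); apply: eq_bigr => j _.
  rewrite [in RHS](coord_vbasis (memvf (psi p))) !linear_sum; apply: eq_bigr => h _.
  by rewrite !linearZ /= (nabla_koszul lc).
rewrite clifford_connection_sum scalerA; congr (_ *: _).
by rewrite !rmorphM fmorphV !rmorph_nat; field.
Qed.

Lemma coord_realZ (h : 'I_(\dim {:Sigma})) (r : R) psi :
  coord (vbasis {:Sigma}) h (r%:C *: psi) =
  Complex (r * complex.Re (coord (vbasis {:Sigma}) h psi))
          (r * complex.Im (coord (vbasis {:Sigma}) h psi)).
Proof. by rewrite linearZ /=; case: (coord _ _ _) => x y; simpc. Qed.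

(** Left translation preserves the e_0-component, so the derivative of t along X is [(X p).2]. *)
Lemma lieD_scaled_spinor (X : G -> G) psi p :
  \sum_h lieD a X (spin_coord h (scaled_spinor a psi)) p *: (vbasis {:Sigma})`_h =
  (a / 2 * (X p).2)%:C *: scaled_spinor a psi p.
Proof.
rewrite [scaled_spinor a psi p](coord_vbasis (memvf _)) scaler_sumr.
apply: eq_bigr => h _; rewrite scalerA; congr (_ *: _).
rewrite /lieD /spin_coord /scaled_spinor coord_realZ.
under eq_fun do rewrite coord_realZ /=.
under [X in Complex _ ('D__ X _)]eq_fun do rewrite coord_realZ /=.
rewrite !derive_exp_tcoord linvE /=; simpc; congr (Complex _ _); ring.
Qed.

Lemma smooth_scaled_spinor psi : smooth_spinor (scaled_spinor a psi : G -> Sigma).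
Proof.
move=> h; rewrite /spin_coord /scaled_spinor; split.
  by under eq_fun do rewrite coord_realZ /=; exact: smooth_exp_tcoord.
by under eq_fun do rewrite coord_realZ /=; exact: smooth_exp_tcoord.
Qed.

(** On psi the vector w acts as a v, and e_0 acts as the scalar - kappa epsilon_0. The derivative of
    the exponential then matches the e_0-component of the Killing equation, and the Clifford term
    its component along v. *)
Lemma Sigma_f_killing (nabla : G -> G -> G) (b : bool) psi : a != 0 ->
  is_levi_civita g (bracket a) nabla -> Sigma_f tau c b psi -> psi != 0 ->
  killing_spinor a g nabla c (killing_const a tau b) (scaled_spinor a psi).
Proof.
move=> a0 lc [fpsi e0psi] psi0.
have t0 : tau != 0.
  by case: htau => ->; rewrite ?oner_neq0 // eq_complex /= oner_eq0 andbF.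
split.
- rewrite !mulf_neq0 ?signr_eq0 //; first by rewrite eq_complex /= oner_eq0 andbF.
  by rewrite fmorph_eq0 mulf_neq0 // invr_neq0 // pnatr_eq0.
- exact: smooth_scaled_spinor.
- by exists 0; rewrite /scaled_spinor /tcoord /= mulr0 mul0r expR0 scale1r.
move=> X _ p; rewrite (spin_connectionE _ _ _ lc) lieD_scaled_spinor.
rewrite /scaled_spinor; move: (expR _)%:C => s.
case: (X p) => v r /=.
set w := vec (phi0 n k a *m v).
have wE : c w psi = a%:C *: c (vec v) psi.
  have -> : w = a *: vec v + vec (fmx *m v).
    by congr (_, _); rewrite /= ?scaler0 ?addr0 // /phi0 mulmxDl mul_scalar_mx.
  by rewrite (rep_linear hc) add_lfunE fpsi addr0 scale_lfunE.
have vrE : (v, r) = r *: e0 + vec v :> G.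
  by congr (_, _); rewrite /= ?scaler0 ?add0r // addr0 /GRing.scale /= mulr1.
rewrite vrE (rep_linear hc) add_lfunE scale_lfunE !linearZ /= wE.
have ve0 : c e0 (c (vec v) psi) = - c (vec v) (c e0 psi).
  exact/(anticommuteC (rep_anticommute hc (metric_vec_e0 _ _ _ _))).
pose kappa := (-1) ^+ b * ('i%C * tau); pose E := (eps0 tau)%:C.
have E2 : E * E = 1 by rewrite -rmorphM -expr2 (eps0_sqr htau).
have k2 : kappa * kappa = - E.
  rewrite /E (eps0E htau) -expr2 exprMn -exprM mulnC exprM sqrrN expr1n expr1n mul1r.
  by rewrite exprMn sqr_i mulN1r.
(* Applying e_0 to psi = kappa e_0 psi, with e_0 squaring to - epsilon_0. *)
have e0E : c e0 psi = (- (kappa * E)) *: psi.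
  by rewrite {1}e0psi linearZ /= (rep_sqr hc) metric_e0 scalerA mulrN.
have -> : killing_const a tau b = kappa * (a / 2)%:C by rewrite /killing_const mulrA.
rewrite !linearZ /= ve0 e0E linearZ /= scalerDr !scalerN !scalerA -scaleNr.
rewrite [c (vec v) (_ *: _)]linearZ /= scalerA.
rewrite !rmorphM fmorphV rmorph_nat /= -/E. congr (_ *: _ + _ *: _).
  transitivity (- (kappa * kappa) * E * (s * (a%:C / 2 * r%:C))); last by ring.
  by rewrite k2 opprK E2 mul1r.
transitivity (E * E * (s * (a%:C / 2 * kappa))); first by ring.
by rewrite E2 mul1r; ring.
Qed.

End SpinConnection.

Lemma yields_killing_subspace (R : realType) (n k : nat) (Sigma : vectType R[i])
  (a : R) (g : solv R n k -> solv R n k -> R) nabla (c : solv R n k -> 'End(Sigma))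
  (S : set Sigma) (U : {vspace Sigma}) lambda :
  (forall psi, psi \in U -> S psi) ->
  (forall psi, S psi -> psi != 0 ->
     killing_spinor a g nabla c lambda (scaled_spinor a psi)) ->
  yields_killing a g nabla c S lambda (\dim U).
Proof.
move=> US SK; exists (fun i => (vbasis U)`_i).
have bU (i : 'I_(\dim U)) : (vbasis U)`_i \in vbasis U.
  by apply: mem_nth; rewrite size_tuple.
have bf : free (vbasis U) := basis_free (vbasisP U).
split=> [i|z z0|i].
- exact/US/vbasis_mem.
(* At the identity t = 0, so the exponential factor is 1 and the relation becomes one between basis
   vectors. *)
- move/freeP: bf; apply; rewrite -[RHS](z0 0); apply: eq_bigr => i _.
  by rewrite /scaled_spinor /tcoord /= mulr0 mul0r expR0 scale1r.
- apply: SK; first exact/US/vbasis_mem.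
  exact: free_not0 (bU i).
Qed.

Theorem proposition3p5 (R : realType) (n k : nat) (hnk : (k.*2 <= n)%N)
  (a : R) (ha : a != 0)
  (delta : 'rV[R]_k) (hdelta : forall i, delta 0 i = 1 \/ delta 0 i = -1)
  (eps : 'rV[R]_(n - k.*2)) (heps : forall i, eps 0 i = 1 \/ eps 0 i = -1)
  (tau : R[i]) (htau : tau = 1 \/ tau = 'i%C)
  (g : solv R n k -> solv R n k -> R) (hg : g = metric delta eps tau)
  (nabla : solv R n k -> solv R n k -> solv R n k)
  (hnabla : is_levi_civita g (bracket a) nabla)
  (Sigma : vectType R[i]) (c : solv R n k -> 'End(Sigma))
  (hc : clifford_rep g c) (hirr : irreducible_rep c) :
  [/\ forall (b : bool) (psi : Sigma), Sigma_f tau c b psi -> psi != 0 ->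
        killing_spinor a g nabla c (killing_const a tau b)
          (scaled_spinor a psi),
      n = k.*2 ->
        [/\ has_dim (sum_set (Sigma_f tau c false) (Sigma_f tau c true)) 1,
            Sigma_f tau c false `&` Sigma_f tau c true = [set 0],
            (forall psi, volume c psi =
                tau * 'i%C ^+ (k + (n.+1 * n.+2)./2) *: psi) ->
              let b := odd (k + npos delta tau) in
              yields_killing a g nabla c (Sigma_f tau c b)
                (killing_const a tau b) 1 &
            (forall psi, volume c psi = 'i%C * tau *: psi) ->
              let b := odd (npos delta tau) in
              yields_killing a g nabla c (Sigma_f tau c b)
                (killing_const a tau b) 1]
    &
      (k.*2 < n)%N -> forall b : bool,
        has_dim (Sigma_f tau c b) (2 ^ ((n - 1)./2 - k))%N /\
        yields_killing a g nabla c (Sigma_f tau c b)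
          (killing_const a tau b) (2 ^ ((n - 1)./2 - k))%N].
Proof.
subst g.
have killing b psi := Sigma_f_killing htau hdelta heps hc (b := b) (psi := psi) ha hnabla.
have SfP := signed_kernelP hc.
split=> [//|nE|kn b]; last first.
  have dimU := dim_signed_kernel hc htau hdelta heps b hirr kn.
  split; first by exists (signed_kernel eps tau c b).
  rewrite -dimU; apply: yields_killing_subspace => [psi /SfP //|]; exact: killing.
have dimK : \dim (joint_kernel c) = 1%N.
  by rewrite (dim_joint_kernel hc htau hdelta heps hirr) nE subnn.
(* Used with m = k for the convention with the power of i, and with m = 0 for the scalar i tau; in
   both cases the whole joint line is a single [Sigma_f]. *)
have yields m : (forall psi, volume c psi = (-1) ^+ m * ('i%C * tau) *: psi) ->
    let b := odd (m + npos delta tau) in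
    yields_killing a (metric delta eps tau) nabla c (Sigma_f tau c b)
      (killing_const a tau b) 1.
  move=> /(signed_kernel_volume hc htau hdelta) KE b.
  rewrite -dimK; apply: yields_killing_subspace; last exact: killing.
  by move=> psi; rewrite KE => /SfP.
split.
- exists (joint_kernel c); split=> // psi.
  exact: (sum_signed_kernels hc htau hdelta heps).
- exact: signed_kernels_disjoint.
- by rewrite orientation_scalar //; exact: yields.
- by move=> vol; apply: (yields 0%N) => psi; rewrite expr0 mul1r.
Qed.
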